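(* The class of all special Gelfand--Dorfman algebras over a field $\Bbbk$ forms a variety; that is, there is a set of identities in the operations $\circ$ and $[\cdot,\cdot]$ such that a Gelfand--Dorfman algebra over $\Bbbk$ is special if and only if it satisfies all of these identities.
   Context: All algebras are over a field $\Bbbk$. A Gelfand--Dorfman algebra (GD-algebra) is a linear space $V$ with two bilinear operations $\circ$ and $[\cdot,\cdot]$ such that: (i) $(V,\circ)$ is a Novikov algebra, i.e. $(a\circ b)\circ c-a\circ(b\circ c)=(b\circ a)\circ c-b\circ(a\circ c)$ and $(a\circ b)\circ c=(a\circ c)\circ b$ for all $a,b,c\in V$; (ii) $(V,[\cdot,\cdot])$ is a Lie algebra; (iii) $b\circ[a,c]=[a,b\circ c]-[c,b\circ a]+[b,a]\circ c-[b,c]\circ a$ for all $a,b,c\in V$. A differential Poisson algebra is a Poisson algebra $(P,\cdot,\{\cdot,\cdot\})$ ($(P,\cdot)$ is associative and commutative, $(P,\{\cdot,\cdot\})$ is a Lie algebra, and $\{x,yz\}=y\{x,z\}+z\{x,y\}$) with a linear map $d:P\to P$ that is a derivation with respect to both operations: $d(xy)=x\,d(y)+d(x)\,y$ and $d\{x,y\}=\{d(x),y\}+\{x,d(y)\}$. Given such $P$, the space $P$ with operations $x\circ y=x\,d(y)$, $[x,y]=\{x,y\}$ is a GD-algebra, denoted $P^{(d)}$. A GD-algebra $V$ is special if there exist a differential Poisson algebra $P$ with derivation $d$ and an injective homomorphism of GD-algebras $V\to P^{(d)}$. *)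

(* Defs.v *)
From HB Require Import structures.
From mathcomp Require Import all_boot all_algebra.

Set Implicit Arguments.
Unset Strict Implicit.
Unset Printing Implicit Defensive.

Import GRing.Theory.
Local Open Scope ring_scope.

Local Reserved Notation "a <o> b" (at level 40, left associativity).
Local Reserved Notation "a <.> b" (at level 40, left associativity).
Local Reserved Notation "[! a , b ]" (at level 0, a, b at level 99).

(* The bracket is alternating, which in characteristic 2 is stronger than
   antisymmetric. *)
HB.mixin Record Lmodule_isLie (k : fieldType) V of GRing.Lmodule k V := {
  lie_br : V -> V -> V;
  lie_br_linearl : forall b : V, linear (lie_br^~ b);
  lie_br_linearr : forall a : V, linear (lie_br a);
  lie_brxx : forall a : V, lie_br a a = 0;
  lie_jacobi : forall a b c : V,
    lie_br a (lie_br b c) + lie_br b (lie_br c a) + lie_br c (lie_br a b) = 0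
}.

#[short(type="lieAlgType")]
HB.structure Definition LieAlg (k : fieldType) :=
  {V of GRing.Lmodule k V & Lmodule_isLie k V}.

Local Notation "[! a , b ]" := (lie_br a b).

HB.mixin Record Lmodule_isNovikov (k : fieldType) V of GRing.Lmodule k V := {
  nov_mul : V -> V -> V;
  nov_mul_linearl : forall b : V, linear (nov_mul^~ b);
  nov_mul_linearr : forall a : V, linear (nov_mul a);
  nov_left_symmetric : forall a b c : V,
    nov_mul (nov_mul a b) c - nov_mul a (nov_mul b c) =
    nov_mul (nov_mul b a) c - nov_mul b (nov_mul a c);
  nov_right_commutative : forall a b c : V,
    nov_mul (nov_mul a b) c = nov_mul (nov_mul a c) b
}.

#[short(type="novikovAlgType")]
HB.structure Definition NovikovAlg (k : fieldType) :=
  {V of GRing.Lmodule k V & Lmodule_isNovikov k V}.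

Local Notation "a <o> b" := (nov_mul a b).

HB.mixin Record Lie_Novikov_isGD (k : fieldType) V
    of LieAlg k V & NovikovAlg k V := {
  gd_compat : forall a b c : V,
    b <o> [! a, c] =
    [! a, b <o> c] - [! c, b <o> a] + [! b, a] <o> c - [! b, c] <o> a
}.

#[short(type="gdAlgType")]
HB.structure Definition GDAlg (k : fieldType) :=
  {V of LieAlg k V & NovikovAlg k V & Lie_Novikov_isGD k V}.

(* The commutative product is not required to have a unit. *)
HB.mixin Record Lie_isPoisson (k : fieldType) P of LieAlg k P := {
  poi_mul : P -> P -> P;
  poi_mul_linearl : forall y : P, linear (poi_mul^~ y);
  poi_mul_linearr : forall x : P, linear (poi_mul x);
  poi_mulA : associative poi_mul;
  poi_mulC : commutative poi_mul;
  poi_leibniz : forall x y z : P,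
    [! x, poi_mul y z] = poi_mul y [! x, z] + poi_mul z [! x, y]
}.

#[short(type="poissonAlgType")]
HB.structure Definition PoissonAlg (k : fieldType) :=
  {P of LieAlg k P & Lie_isPoisson k P}.

Local Notation "x <.> y" := (poi_mul x y).

HB.mixin Record Poisson_isDifferential (k : fieldType) P
    of PoissonAlg k P := {
  poi_d : P -> P;
  poi_d_linear : linear poi_d;
  poi_d_mul : forall x y : P, poi_d (x <.> y) = x <.> poi_d y + poi_d x <.> y;
  poi_d_br : forall x y : P, poi_d [! x, y] = [! poi_d x, y] + [! x, poi_d y]
}.

#[short(type="diffPoissonAlgType")]
HB.structure Definition DiffPoissonAlg (k : fieldType) :=
  {P of PoissonAlg k P & Poisson_isDifferential k P}.

(* P^(d): the carrier and bracket of P, with x o y = x * d y. *)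
Definition gd_of (k : fieldType) (P : diffPoissonAlgType k) : Type := P.

Section GDOf.
Variables (k : fieldType) (P : diffPoissonAlgType k).
Implicit Types x y z : P.

HB.instance Definition _ := LieAlg.copy (gd_of P) P.

Let circ x y : P := x <.> poi_d y.

Let mulDr x y z : x <.> (y + z) = x <.> y + x <.> z.
Proof. by have := poi_mul_linearr x 1 y z; rewrite !scale1r. Qed.

Let brC x y : [! x, y] = - [! y, x].
Proof.
have brDl a b c : [! a + b, c] = [! a, c] + [! b, c] :> P.
  by have := lie_br_linearl c 1 a b; rewrite !scale1r.
have brDr a b c : [! a, b + c] = [! a, b] + [! a, c] :> P.
  by have := lie_br_linearr a 1 b c; rewrite !scale1r.
have := lie_brxx (x + y); rewrite brDl !brDr !lie_brxx add0r addr0.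
by move/eqP; rewrite addr_eq0 => /eqP.
Qed.

Let mulNr x y : x <.> (- y) = - (x <.> y).
Proof.
have x0 : x <.> 0 = 0 by apply: (addrI (x <.> 0)); rewrite -mulDr !addr0.
by apply/eqP; rewrite -addr_eq0 -mulDr addNr x0.
Qed.

Let circ_linearl y : linear (circ^~ y).
Proof. by move=> a u v; rewrite /circ poi_mul_linearl. Qed.

Let circ_linearr x : linear (circ x).
Proof. by move=> a u v; rewrite /circ poi_d_linear poi_mul_linearr. Qed.

Let circ_left_symmetric x y z :
  circ (circ x y) z - circ x (circ y z) =
  circ (circ y x) z - circ y (circ x z).
Proof.
have assoc u v : circ (circ u v) z - circ u (circ v z) =
    - (u <.> v <.> poi_d (poi_d z)).
  rewrite /circ poi_d_mul mulDr !poi_mulA opprD addrCA subrr addr0 //.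
by rewrite !assoc [x <.> y]poi_mulC.
Qed.

Let circ_right_commutative x y z : circ (circ x y) z = circ (circ x z) y.
Proof. by rewrite /circ -!poi_mulA [poi_d y <.> _]poi_mulC. Qed.

HB.instance Definition _ := Lmodule_isNovikov.Build k (gd_of P)
  circ_linearl circ_linearr circ_left_symmetric circ_right_commutative.

Let circ_compat x y z :
  circ y [! x, z] =
  [! x, circ y z] - [! z, circ y x] + circ [! y, x] z - circ [! y, z] x.
Proof.
rewrite /circ poi_d_br !poi_leibniz mulDr.
rewrite [[! x, y]]brC [[! z, y]]brC [[! z, poi_d x]]brC !mulNr.
rewrite ![_ <.> [! y, _]]poi_mulC opprD !opprK addrACA addrAC.
set u := _ <.> poi_d z; set v := _ <.> poi_d x.
rewrite -[RHS]addrA [in RHS](addrAC (_ <.> _)) -[RHS]addrA.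
by rewrite addrACA addNr subrr !addr0 addrC.
Qed.

HB.instance Definition _ :=
  Lie_Novikov_isGD.Build k (gd_of P) circ_compat.

End GDOf.

Definition gd_hom (k : fieldType) (V W : gdAlgType k) (f : V -> W) : Prop :=
  [/\ linear f,
      {morph f : a b / a <o> b} &
      {morph f : a b / [! a, b]}].

Definition special (k : fieldType) (V : gdAlgType k) : Prop :=
  exists (P : diffPoissonAlgType k) (f : V -> gd_of P),
    gd_hom f /\ injective f.

(* Expressions for the elements of the free nonassociative algebra with two
   bilinear operations over k, on countably many variables. *)
Inductive gd_poly (k : fieldType) : Type :=
| GDVar of nat
| GDZero
| GDAdd of gd_poly k & gd_poly k
| GDScale of k & gd_poly k
| GDCirc of gd_poly k & gd_poly k
| GDBr of gd_poly k & gd_poly k.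

Fixpoint gd_eval (k : fieldType) (V : gdAlgType k) (v : nat -> V)
    (p : gd_poly k) : V :=
  match p with
  | GDVar n => v n
  | GDZero => 0
  | GDAdd p q => gd_eval v p + gd_eval v q
  | GDScale a p => a *: gd_eval v p
  | GDCirc p q => gd_eval v p <o> gd_eval v q
  | GDBr p q => [! gd_eval v p, gd_eval v q]
  end.

(* V satisfies the identity p = 0. *)
Definition gd_satisfies (k : fieldType) (V : gdAlgType k) (p : gd_poly k) :
    Prop :=
  forall v : nat -> V, gd_eval v p = 0.

(* Main.v *)
(** Let V satisfy every identity of all the algebras P^(d), let Q be the free
differential Poisson algebra on V, S the GD-subalgebra of Q^(d) generated by V,
and I the kernel of the evaluation S -> V, which is well defined because V
satisfies the identities.  In Q[t, 1/t], with derivation t d and bracket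
t {.,.}, the elements v t^-1 generate a copy of S.  Put K_0 = I,
K_{n+1} = {q | S q <= K_n} and K_{-n-1} = S K_{-n}.  The Leibniz rules give
S K_n <= K_{n-1}, d K_n <= K_{n+1} and {S, K_n} <= K_n, so the sum J of the
K_{n+1} t^n is stable under d and under multiplication by, and bracket with, the
differential Poisson algebra A generated by the v t^-1.  Since J meets S t^-1
in I t^-1, V = S/I embeds into A/(A :&: J). *)

Require Import Defs.
From HB Require Import structures.
From mathcomp Require Import all_boot all_algebra.
From mathcomp Require Import generic_quotient boolp.
From mathcomp Require Import zify.

Set Implicit Arguments.
Unset Strict Implicit.
Unset Printing Implicit Defensive.

Import GRing.Theory.
Local Open Scope ring_scope.
Local Open Scope quotient_scope.

(** * Consequences of linearity for unbundled maps *)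

Section LinearFunctions.
Variables (k : fieldType) (U W : lmodType k) (f : U -> W).
Hypothesis f_lin : linear f.

Lemma linear_fun0 : f 0 = 0.
Proof. by have := f_lin (-1) 0 0; rewrite !scaleN1r addrC subrr addrC subrr. Qed.

Lemma linear_funD x y : f (x + y) = f x + f y.
Proof. by have := f_lin 1 x y; rewrite !scale1r. Qed.

Lemma linear_funZ a x : f (a *: x) = a *: f x.
Proof. by rewrite -[a *: x]addr0 f_lin linear_fun0 addr0. Qed.

Lemma linear_funN x : f (- x) = - f x.
Proof. by rewrite -!scaleN1r linear_funZ. Qed.

Lemma linear_funB x y : f (x - y) = f x - f y.
Proof. by rewrite linear_funD linear_funN. Qed.

Lemma linear_fun_sum (T : Type) (r : seq T) (C : pred T) (F : T -> U) :
  f (\sum_(i <- r | C i) F i) = \sum_(i <- r | C i) f (F i).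
Proof. exact: (big_morph f linear_funD linear_fun0). Qed.

End LinearFunctions.

(** * Identities in Poisson algebras *)

Section PoissonTheory.
Variables (k : fieldType) (P : poissonAlgType k).
Implicit Types x y z : P.

Lemma lie_brC x y : lie_br x y = - lie_br y x.
Proof.
have := lie_brxx (x + y).
rewrite (linear_funD (lie_br_linearr _)) !(linear_funD (lie_br_linearl _)).
rewrite !lie_brxx add0r addr0.
by move/eqP; rewrite addrC addr_eq0 => /eqP.
Qed.

Lemma poi_leibnizl x y z :
  lie_br (poi_mul x y) z = poi_mul x (lie_br y z) + poi_mul y (lie_br x z).
Proof.
rewrite lie_brC poi_leibniz opprD -!(linear_funN (poi_mul_linearr _)).
by rewrite -!lie_brC.
Qed.

Lemma lie_jacobil x y z :
  lie_br (lie_br x y) z = lie_br x (lie_br y z) - lie_br y (lie_br x z).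
Proof.
rewrite [LHS]lie_brC -(linear_funN (lie_br_linearr y)) -(lie_brC z x).
by apply/esym/eqP; rewrite -addr_eq0 lie_jacobi.
Qed.

End PoissonTheory.

(** * Differential Poisson terms and their quotients by congruences *)

Inductive dp_term (k : fieldType) (X : Type) : Type :=
| DPVar of X
| DPZero
| DPAdd of dp_term k X & dp_term k X
| DPScale of k & dp_term k X
| DPMul of dp_term k X & dp_term k X
| DPBr of dp_term k X & dp_term k X
| DPD of dp_term k X.
Arguments DPVar {k X}.
Arguments DPZero {k X}.

(** Quotients are formed with chosen representatives. The choice structure is obtained classically,
    so [X] may be any type, in particular the carrier of an algebra. *)
HB.instance Definition _ (k : fieldType) (X : Type) :=
  gen_eqMixin (dp_term k X).
HB.instance Definition _ (k : fieldType) (X : Type) :=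
  gen_choiceMixin (dp_term k X).

Fixpoint dp_eval (k : fieldType) (X : Type) (P : diffPoissonAlgType k)
    (f : X -> P) (t : dp_term k X) : P :=
  match t with
  | DPVar x => f x
  | DPZero => 0
  | DPAdd s t => dp_eval f s + dp_eval f t
  | DPScale a t => a *: dp_eval f t
  | DPMul s t => poi_mul (dp_eval f s) (dp_eval f t)
  | DPBr s t => lie_br (dp_eval f s) (dp_eval f t)
  | DPD t => poi_d (dp_eval f t)
  end.

(** Opposites are written [DPScale (-1)], and linearity has the shape [a x + y] of the predicate
    [linear], so that each constructor matches one field of the algebra structures. *)
Inductive dp_axiom (k : fieldType) (X : Type) :
    dp_term k X -> dp_term k X -> Prop :=
| DPAddA x y z : dp_axiom (DPAdd x (DPAdd y z)) (DPAdd (DPAdd x y) z)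
| DPAddC x y : dp_axiom (DPAdd x y) (DPAdd y x)
| DPAdd0 x : dp_axiom (DPAdd DPZero x) x
| DPAddN x : dp_axiom (DPAdd (DPScale (-1) x) x) DPZero
| DPScaleA a b x : dp_axiom (DPScale a (DPScale b x)) (DPScale (a * b) x)
| DPScale1 x : dp_axiom (DPScale 1 x) x
| DPScaleDr a x y :
    dp_axiom (DPScale a (DPAdd x y)) (DPAdd (DPScale a x) (DPScale a y))
| DPScaleDl x a b :
    dp_axiom (DPScale (a + b) x) (DPAdd (DPScale a x) (DPScale b x))
| DPBrLinl z a x y :
    dp_axiom (DPBr (DPAdd (DPScale a x) y) z)
             (DPAdd (DPScale a (DPBr x z)) (DPBr y z))
| DPBrLinr z a x y :
    dp_axiom (DPBr z (DPAdd (DPScale a x) y))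
             (DPAdd (DPScale a (DPBr z x)) (DPBr z y))
| DPBrxx x : dp_axiom (DPBr x x) DPZero
| DPJacobi x y z :
    dp_axiom (DPAdd (DPAdd (DPBr x (DPBr y z)) (DPBr y (DPBr z x)))
                    (DPBr z (DPBr x y))) DPZero
| DPMulLinl z a x y :
    dp_axiom (DPMul (DPAdd (DPScale a x) y) z)
             (DPAdd (DPScale a (DPMul x z)) (DPMul y z))
| DPMulLinr z a x y :
    dp_axiom (DPMul z (DPAdd (DPScale a x) y))
             (DPAdd (DPScale a (DPMul z x)) (DPMul z y))
| DPMulA x y z : dp_axiom (DPMul x (DPMul y z)) (DPMul (DPMul x y) z)
| DPMulC x y : dp_axiom (DPMul x y) (DPMul y x)
| DPLeibniz x y z :
    dp_axiom (DPBr x (DPMul y z))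
             (DPAdd (DPMul y (DPBr x z)) (DPMul z (DPBr x y)))
| DPDLin a x y :
    dp_axiom (DPD (DPAdd (DPScale a x) y)) (DPAdd (DPScale a (DPD x)) (DPD y))
| DPDMul x y :
    dp_axiom (DPD (DPMul x y)) (DPAdd (DPMul x (DPD y)) (DPMul (DPD x) y))
| DPDBr x y :
    dp_axiom (DPD (DPBr x y)) (DPAdd (DPBr (DPD x) y) (DPBr x (DPD y))).

(** One quotient construction serves for three algebras: the free one, the Laurent polynomials and
    the final quotient of a subalgebra. Each has only to supply a congruence containing the laws. *)
Record dp_congr (k : fieldType) (X : Type) := DPCongr {
  dp_rel :> dp_term k X -> dp_term k X -> Prop;
  dp_rel_refl : forall x, dp_rel x x;
  dp_rel_sym : forall x y, dp_rel x y -> dp_rel y x;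
  dp_rel_trans : forall y x z, dp_rel x y -> dp_rel y z -> dp_rel x z;
  dp_rel_add : forall x x' y y',
    dp_rel x x' -> dp_rel y y' -> dp_rel (DPAdd x y) (DPAdd x' y');
  dp_rel_scale : forall a x x',
    dp_rel x x' -> dp_rel (DPScale a x) (DPScale a x');
  dp_rel_mul : forall x x' y y',
    dp_rel x x' -> dp_rel y y' -> dp_rel (DPMul x y) (DPMul x' y');
  dp_rel_br : forall x x' y y',
    dp_rel x x' -> dp_rel y y' -> dp_rel (DPBr x y) (DPBr x' y');
  dp_rel_d : forall x x', dp_rel x x' -> dp_rel (DPD x) (DPD x');
  dp_rel_axiom : forall x y, dp_axiom x y -> dp_rel x y
}.

Section Quotient.
Variables (k : fieldType) (X : Type) (R : dp_congr k X).
Implicit Types s t : dp_term k X.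

Definition dp_relb s t := `[< R s t >].

Lemma dp_relb_refl : reflexive dp_relb.
Proof. by move=> x; apply/asboolP; apply: dp_rel_refl. Qed.

Lemma dp_relb_sym : symmetric dp_relb.
Proof.
by move=> x y; apply/idP/idP => /asboolP H; apply/asboolP; apply: dp_rel_sym.
Qed.

Lemma dp_relb_trans : transitive dp_relb.
Proof.
move=> y x z /asboolP H /asboolP H'; apply/asboolP.
exact: dp_rel_trans H H'.
Qed.

Canonical dp_equiv := EquivRel dp_relb dp_relb_refl dp_relb_sym dp_relb_trans.

Definition dp_quot : Type := {eq_quot dp_equiv}.

HB.instance Definition _ := Choice.on dp_quot.

Definition dp_cls t : dp_quot := \pi_({eq_quot dp_equiv}) t.
Let rep (q : dp_quot) : dp_term k X := repr (q : {eq_quot dp_equiv}).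

Lemma dp_clsP s t : dp_cls s = dp_cls t <-> R s t.
Proof.
split=> [/eqmodP /asboolP //|H]; apply/eqmodP; exact/asboolP.
Qed.

Lemma dp_clsW (Q : dp_quot -> Prop) : (forall t, Q (dp_cls t)) -> forall q, Q q.
Proof. by move=> H; elim/quotW. Qed.

Let repK t : R (rep (dp_cls t)) t.
Proof. by apply/dp_clsP; rewrite /dp_cls /rep reprK. Qed.

Let qadd p q := dp_cls (DPAdd (rep p) (rep q)).
Let qscale a q := dp_cls (DPScale a (rep q)).
Let qmul p q := dp_cls (DPMul (rep p) (rep q)).
Let qbr p q := dp_cls (DPBr (rep p) (rep q)).
Let qd q := dp_cls (DPD (rep q)).

Let qaddE s t : qadd (dp_cls s) (dp_cls t) = dp_cls (DPAdd s t).
Proof. by apply/dp_clsP/dp_rel_add; apply: repK. Qed.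
Let qscaleE a t : qscale a (dp_cls t) = dp_cls (DPScale a t).
Proof. by apply/dp_clsP/dp_rel_scale; apply: repK. Qed.
Let qmulE s t : qmul (dp_cls s) (dp_cls t) = dp_cls (DPMul s t).
Proof. by apply/dp_clsP/dp_rel_mul; apply: repK. Qed.
Let qbrE s t : qbr (dp_cls s) (dp_cls t) = dp_cls (DPBr s t).
Proof. by apply/dp_clsP/dp_rel_br; apply: repK. Qed.
Let qdE t : qd (dp_cls t) = dp_cls (DPD t).
Proof. by apply/dp_clsP/dp_rel_d; apply: repK. Qed.

Let qE := (qaddE, qscaleE, qmulE, qbrE, qdE).

(** On representatives, every law of the quotient is literally one constructor of [dp_axiom]. *)
Ltac by_axiom :=
  repeat (elim/dp_clsW => ?); rewrite !qE; apply/dp_clsP;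
  apply: dp_rel_axiom; constructor.

Let qaddA : associative qadd. Proof. by_axiom. Qed.
Let qaddC : commutative qadd. Proof. by_axiom. Qed.
Let qadd0 : left_id (dp_cls DPZero) qadd. Proof. by_axiom. Qed.
Let qaddN : left_inverse (dp_cls DPZero) (qscale (-1)) qadd.
Proof. by_axiom. Qed.

HB.instance Definition _ := GRing.isZmodule.Build dp_quot
  qaddA qaddC qadd0 qaddN.

Let qscaleA a b q : qscale a (qscale b q) = qscale (a * b) q.
Proof. by move: q; by_axiom. Qed.
Let qscale1 : left_id 1 qscale. Proof. by_axiom. Qed.
Let qscaleDr : right_distributive qscale qadd.
Proof. by move=> a; by_axiom. Qed.
Let qscaleDl q : {morph qscale^~ q : a b / a + b >-> qadd a b}.
Proof. by move=> a b; move: q; by_axiom. Qed.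

HB.instance Definition _ := GRing.Zmodule_isLmodule.Build k dp_quot
  qscaleA qscale1 qscaleDr qscaleDl.

Let gE := ((fun p q : dp_quot => erefl : p + q = qadd p q),
           (fun a (q : dp_quot) => erefl : a *: q = qscale a q),
           (erefl : 0 = dp_cls DPZero)).

Ltac by_axiom' :=
  repeat (elim/dp_clsW => ?); rewrite !gE !qE; apply/dp_clsP;
  apply: dp_rel_axiom; constructor.

Let qbr_linl p : linear (qbr^~ p).
Proof. by move=> a; move: p; by_axiom'. Qed.
Let qbr_linr p : linear (qbr p).
Proof. by move=> a; move: p; by_axiom'. Qed.
Let qbrxx p : qbr p p = 0.
Proof. by move: p; by_axiom'. Qed.
Let qjacobi p q r : qbr p (qbr q r) + qbr q (qbr r p) + qbr r (qbr p q) = 0.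
Proof. by move: p q r; by_axiom'. Qed.

HB.instance Definition _ := Lmodule_isLie.Build k dp_quot
  qbr_linl qbr_linr qbrxx qjacobi.

Let qmul_linl p : linear (qmul^~ p).
Proof. by move=> a; move: p; by_axiom'. Qed.
Let qmul_linr p : linear (qmul p).
Proof. by move=> a; move: p; by_axiom'. Qed.
Let qmulA : associative qmul. Proof. by_axiom. Qed.
Let qmulC : commutative qmul. Proof. by_axiom. Qed.
Let qleibniz p q r : qbr p (qmul q r) = qmul q (qbr p r) + qmul r (qbr p q).
Proof. by move: p q r; by_axiom'. Qed.

HB.instance Definition _ := Lie_isPoisson.Build k dp_quot
  qmul_linl qmul_linr qmulA qmulC qleibniz.

Let qd_lin : linear qd.
Proof. by move=> a; by_axiom'. Qed.
Let qd_mul p q : qd (qmul p q) = qmul p (qd q) + qmul (qd p) q.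
Proof. by move: p q; by_axiom'. Qed.
Let qd_br p q : qd (qbr p q) = qbr (qd p) q + qbr p (qd q).
Proof. by move: p q; by_axiom'. Qed.

HB.instance Definition _ := Poisson_isDifferential.Build k dp_quot
  qd_lin qd_mul qd_br.

Lemma dp_cls0 : dp_cls DPZero = 0. Proof. by []. Qed.
Lemma dp_clsD s t : dp_cls (DPAdd s t) = dp_cls s + dp_cls t.
Proof. by rewrite -qaddE. Qed.
Lemma dp_clsZ a t : dp_cls (DPScale a t) = a *: dp_cls t.
Proof. by rewrite -qscaleE. Qed.
Lemma dp_clsM s t : dp_cls (DPMul s t) = poi_mul (dp_cls s) (dp_cls t).
Proof. by rewrite -qmulE. Qed.
Lemma dp_clsB s t : dp_cls (DPBr s t) = lie_br (dp_cls s) (dp_cls t).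
Proof. by rewrite -qbrE. Qed.
Lemma dp_clsd t : dp_cls (DPD t) = poi_d (dp_cls t).
Proof. by rewrite -qdE. Qed.

End Quotient.

Lemma dp_axiom_eval (k : fieldType) (X : Type) (P : diffPoissonAlgType k)
    (f : X -> P) s t :
  dp_axiom s t -> dp_eval f s = dp_eval f t.
Proof.
case=> * /=.
- exact: addrA.
- exact: addrC.
- exact: add0r.
- by rewrite scaleN1r addNr.
- exact: scalerA.
- exact: scale1r.
- exact: scalerDr.
- exact: scalerDl.
- exact: lie_br_linearl.
- exact: lie_br_linearr.
- exact: lie_brxx.
- exact: lie_jacobi.
- exact: poi_mul_linearl.
- exact: poi_mul_linearr.
- exact: poi_mulA.
- exact: poi_mulC.
- exact: poi_leibniz.
- exact: poi_d_linear.
- exact: poi_d_mul.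
- exact: poi_d_br.
Qed.

(** * The free differential Poisson algebra *)

Section FreeDifferentialPoisson.
Variables (k : fieldType) (X : Type).

(** The congruence is semantic: terms are identified when they agree under every assignment in every
    differential Poisson algebra. The universal property is then immediate, with no induction on
    derivations. *)
Definition dp_free_rel (s t : dp_term k X) : Prop :=
  forall (P : diffPoissonAlgType k) (f : X -> P), dp_eval f s = dp_eval f t.

Definition dp_free_congr : dp_congr k X.
Proof.
apply: (@DPCongr k X dp_free_rel).
- by [].
- by move=> x y H P f.
- by move=> y x z H H' P f; rewrite H H'.
- by move=> x x' y y' H H' P f /=; rewrite H H'.
- by move=> a x x' H P f /=; rewrite H.
- by move=> x x' y y' H H' P f /=; rewrite H H'.
- by move=> x x' y y' H H' P f /=; rewrite H H'.
- by move=> x x' H P f /=; rewrite H.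
- by move=> x y H P f; apply: dp_axiom_eval.
Defined.

Definition dp_free : diffPoissonAlgType k := dp_quot dp_free_congr.

Definition dp_free_var (x : X) : dp_free := dp_cls dp_free_congr (DPVar x).

End FreeDifferentialPoisson.

(** * Laurent polynomials as lists of monomials, and their convolutions *)

Section Convolution.
Variables (k : fieldType) (Q : lmodType k).
Implicit Types (l m : seq (Q * int)) (w e : int).

(** A list of pairs [(q, n)] stands for the sum of the [q t^n]; exponents may repeat, and [lcoef w]
    reads the coefficient of [t^w]. *)
Definition lcoef w l : Q := \sum_(p <- l | p.2 == w) p.1.

Lemma lcoef_nil w : lcoef w [::] = 0.
Proof. exact: big_nil. Qed.

Lemma lcoef_cons w p l :
  lcoef w (p :: l) = (if p.2 == w then p.1 else 0) + lcoef w l.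
Proof. by rewrite /lcoef big_cons; case: ifP; rewrite ?add0r. Qed.

Lemma lcoef_cat w l m : lcoef w (l ++ m) = lcoef w l + lcoef w m.
Proof. exact: big_cat. Qed.

Lemma lcoef1 w p : lcoef w [:: p] = if p.2 == w then p.1 else 0.
Proof. by rewrite lcoef_cons lcoef_nil addr0. Qed.

Lemma lcoef_map (f : Q -> Q) e w l : linear f ->
  lcoef w [seq (f p.1, p.2 + e) | p <- l] = f (lcoef (w - e) l).
Proof.
move=> f_lin; rewrite /lcoef big_map /= (linear_fun_sum f_lin).
by apply: eq_bigl => p; rewrite [RHS]eq_sym subr_eq eq_sym.
Qed.

Variable op : Q -> Q -> Q.
Hypothesis op_linl : forall y, linear (op^~ y).
Hypothesis op_linr : forall x, linear (op x).

(** The shift [e] is the power of [t] built into the operation: 0 for the product, 1 for the bracket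
    [t {.,.}]. *)
Definition lconv e l m : seq (Q * int) :=
  [seq (op p.1 q.1, p.2 + q.2 + e) | p <- l, q <- m].

(** This expansion and its mirror image keep one factor as a list and see the other only through its
    coefficients. Together they show that a convolution depends only on the coefficients of its
    factors, and they reduce laws to single monomials. *)
Lemma lcoef_lconvl e w l m :
  lcoef w (lconv e l m) = \sum_(p <- l) op p.1 (lcoef (w - p.2 - e) m).
Proof.
rewrite /lcoef big_mkcond big_allpairs_dep /=; apply: eq_bigr => p _.
rewrite (linear_fun_sum (op_linr _)) [RHS]big_mkcond /=; apply: eq_bigr => q _.
by congr (if _ then _ else _); lia.
Qed.

Lemma lcoef_lconvr e w l m :
  lcoef w (lconv e l m) = \sum_(q <- m) op (lcoef (w - q.2 - e) l) q.1.
Proof.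
rewrite /lcoef big_mkcond big_allpairs_dep /= exchange_big /=.
apply: eq_bigr => q _.
rewrite (linear_fun_sum (op_linl _)) [RHS]big_mkcond /=; apply: eq_bigr => p _.
by congr (if _ then _ else _); lia.
Qed.

End Convolution.

(** * The differential Poisson algebra [Q[t, 1/t]] *)

Section Laurent.
Variables (k : fieldType) (Q : diffPoissonAlgType k).
Implicit Types (l m n : seq (Q * int)) (s t : dp_term k (Q * int)) (w e : int).

(** Here [t] is a constant for [d] and central for the bracket, so multiplying both operations by
    [t] preserves all the laws. *)
Let mul := lconv (@poi_mul k Q) 0.
Let br := lconv (@lie_br k Q) 1.
Let dl l := [seq (poi_d p.1, p.2 + 1) | p <- l].

Let mulE w l m : lcoef w (mul l m) =
  \sum_(p <- l) poi_mul p.1 (lcoef (w - p.2) m).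
Proof.
by rewrite lcoef_lconvl; [under eq_bigr do rewrite subr0|exact: poi_mul_linearr].
Qed.

Let mulEr w l m : lcoef w (mul l m) =
  \sum_(q <- m) poi_mul (lcoef (w - q.2) l) q.1.
Proof.
by rewrite lcoef_lconvr; [under eq_bigr do rewrite subr0|exact: poi_mul_linearl].
Qed.

Let brE w l m : lcoef w (br l m) =
  \sum_(p <- l) lie_br p.1 (lcoef (w - p.2 - 1) m).
Proof. by rewrite lcoef_lconvl //; exact: lie_br_linearr. Qed.

Let brEr w l m : lcoef w (br l m) =
  \sum_(q <- m) lie_br (lcoef (w - q.2 - 1) l) q.1.
Proof. by rewrite lcoef_lconvr //; exact: lie_br_linearl. Qed.

Let dE w l : lcoef w (dl l) = poi_d (lcoef (w - 1) l).
Proof. by rewrite lcoef_map //; exact: poi_d_linear. Qed.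

Let scaleE a w l : lcoef w [seq (a *: p.1, p.2) | p <- l] = a *: lcoef w l.
Proof. by rewrite /lcoef big_map scaler_sumr. Qed.

Fixpoint laurent_seq t : seq (Q * int) :=
  match t with
  | DPVar p => [:: p]
  | DPZero => [::]
  | DPAdd s t => laurent_seq s ++ laurent_seq t
  | DPScale a t => [seq (a *: p.1, p.2) | p <- laurent_seq t]
  | DPMul s t => lconv (@poi_mul k Q) 0 (laurent_seq s) (laurent_seq t)
  | DPBr s t => lconv (@lie_br k Q) 1 (laurent_seq s) (laurent_seq t)
  | DPD t => [seq (poi_d p.1, p.2 + 1) | p <- laurent_seq t]
  end.

(* [Q[t, 1/t]] is presented by generators [(q, n)], standing for [q t^n], two
   terms being identified when all their coefficients agree. *)
Definition laurent_rel s t : Prop :=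
  forall w, lcoef w (laurent_seq s) = lcoef w (laurent_seq t).

Let mulA w l m n : lcoef w (mul l (mul m n)) = lcoef w (mul (mul l m) n).
Proof.
rewrite !mulE big_allpairs_dep /=; apply: eq_bigr => p _.
rewrite mulE (linear_fun_sum (poi_mul_linearr _)); apply: eq_bigr => q _.
by rewrite poi_mulA addr0 opprD addrA.
Qed.

Let mulC w l m : lcoef w (mul l m) = lcoef w (mul m l).
Proof. by rewrite mulE mulEr; under eq_bigr do rewrite poi_mulC. Qed.

(** The diagonal summands vanish and the others cancel in pairs [F p q + F q p]. The pairing is done
    by induction on the list, since antisymmetry alone would not suffice in characteristic 2. *)
Let brxx w l : lcoef w (br l l) = 0.
Proof.
rewrite /lcoef big_mkcond big_allpairs_dep /=.
set F := fun p q : Q * int => if p.2 + q.2 + 1 == w then lie_br p.1 q.1 else 0.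
rewrite -[LHS]/(\sum_(p <- l) \sum_(q <- l) F p q).
have Fpp p : F p p = 0 by rewrite /F lie_brxx if_same.
have FC p q : F p q + F q p = 0.
  by rewrite /F (addrC q.2) (lie_brC p.1); case: ifP; rewrite ?addNr ?addr0.
elim: l => [|p l IH]; first by rewrite big_nil.
rewrite big_cons; under [X in _ + X]eq_bigr do rewrite big_cons.
rewrite big_cons big_split /= IH Fpp add0r addr0 -big_split big1 //=.
Qed.

(** The shift 2 collects one factor [t] from each bracket. *)
Let sum_brE w l m n :
  lcoef w (br l (br m n)) = \sum_(p <- l) \sum_(q <- m)
    lie_br p.1 (lie_br q.1 (lcoef (w - p.2 - q.2 - 2) n)).
Proof.
rewrite brE; apply: eq_bigr => p _.
rewrite brE (linear_fun_sum (lie_br_linearr _)); apply: eq_bigr => q _.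
by congr (lie_br _ (lie_br _ (lcoef _ _))); lia.
Qed.

(** All three terms become double sums over the monomials of [l] and [m], with [n] present only
    through one coefficient; the Jacobi identity of [Q] then applies to each summand. The Leibniz
    rule below follows the same pattern. *)
Let jacobi w l m n : lcoef w (br l (br m n)) + lcoef w (br m (br n l)) +
  lcoef w (br n (br l m)) = 0.
Proof.
rewrite sum_brE.
have -> : lcoef w (br m (br n l)) = \sum_(p <- l) \sum_(q <- m)
    lie_br q.1 (lie_br (lcoef (w - p.2 - q.2 - 2) n) p.1).
  rewrite exchange_big brE; apply: eq_bigr => q _.
  rewrite brEr (linear_fun_sum (lie_br_linearr _)); apply: eq_bigr => p _.
  by congr (lie_br _ (lie_br (lcoef _ _) _)); lia.
have -> : lcoef w (br n (br l m)) = \sum_(p <- l) \sum_(q <- m)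
    lie_br (lcoef (w - p.2 - q.2 - 2) n) (lie_br p.1 q.1).
  rewrite brEr big_allpairs_dep /=.
  apply: eq_bigr => p _; apply: eq_bigr => q _.
  by congr (lie_br (lcoef _ _) _); lia.
rewrite -!big_split big1 //= => p _; rewrite -!big_split big1 //= => q _.
exact: lie_jacobi.
Qed.

Let leibniz w l m n : lcoef w (br l (mul m n)) =
  lcoef w (mul m (br l n)) + lcoef w (mul n (br l m)).
Proof.
have -> : lcoef w (br l (mul m n)) = \sum_(p <- l) \sum_(q <- m)
    lie_br p.1 (poi_mul q.1 (lcoef (w - p.2 - q.2 - 1) n)).
  rewrite brE; apply: eq_bigr => p _.
  rewrite mulE (linear_fun_sum (lie_br_linearr _)); apply: eq_bigr => q _.
  by congr (lie_br _ (poi_mul _ (lcoef _ _))); lia.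
have -> : lcoef w (mul m (br l n)) = \sum_(p <- l) \sum_(q <- m)
    poi_mul q.1 (lie_br p.1 (lcoef (w - p.2 - q.2 - 1) n)).
  rewrite exchange_big mulE; apply: eq_bigr => q _.
  rewrite brE (linear_fun_sum (poi_mul_linearr _)); apply: eq_bigr => p _.
  by congr (poi_mul _ (lie_br _ (lcoef _ _))); lia.
have -> : lcoef w (mul n (br l m)) = \sum_(p <- l) \sum_(q <- m)
    poi_mul (lcoef (w - p.2 - q.2 - 1) n) (lie_br p.1 q.1).
  rewrite mulEr big_allpairs_dep /=.
  apply: eq_bigr => p _; apply: eq_bigr => q _.
  by congr (poi_mul (lcoef _ _) _); lia.
rewrite -big_split; apply: eq_bigr => p _.
rewrite -big_split; apply: eq_bigr => q _.
exact: poi_leibniz.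
Qed.

Let dmul w l m : lcoef w (dl (mul l m)) =
  lcoef w (mul l (dl m)) + lcoef w (mul (dl l) m).
Proof.
rewrite dE !mulE big_map /= (linear_fun_sum poi_d_linear) -big_split.
apply: eq_bigr => p _ /=; rewrite poi_d_mul dE.
by congr (poi_mul _ (poi_d (lcoef _ _)) + poi_mul _ (lcoef _ _)); lia.
Qed.

Let dbr w l m : lcoef w (dl (br l m)) =
  lcoef w (br (dl l) m) + lcoef w (br l (dl m)).
Proof.
rewrite dE !brE big_map /= (linear_fun_sum poi_d_linear) -big_split.
apply: eq_bigr => p _ /=; rewrite poi_d_br dE.
by congr (lie_br _ (lcoef _ _) + lie_br _ (poi_d (lcoef _ _))); lia.
Qed.

Lemma laurent_axiom s t : dp_axiom s t -> laurent_rel s t.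
Proof.
case=> *; move=> w /=.
- by rewrite catA.
- by rewrite !lcoef_cat addrC.
- by [].
- by rewrite lcoef_cat scaleE scaleN1r addNr lcoef_nil.
- by rewrite !scaleE scalerA.
- by rewrite scaleE scale1r.
- by rewrite !(lcoef_cat, scaleE) scalerDr.
- by rewrite !(lcoef_cat, scaleE) scalerDl.
- rewrite !(lcoef_cat, scaleE) !brEr scaler_sumr -big_split /=.
  by apply: eq_bigr => q _; rewrite lcoef_cat scaleE lie_br_linearl.
- rewrite !(lcoef_cat, scaleE) !brE scaler_sumr -big_split /=.
  by apply: eq_bigr => q _; rewrite lcoef_cat scaleE lie_br_linearr.
- by rewrite brxx lcoef_nil.
- by rewrite !lcoef_cat jacobi lcoef_nil.
- rewrite !(lcoef_cat, scaleE) !mulEr scaler_sumr -big_split /=.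
  by apply: eq_bigr => q _; rewrite lcoef_cat scaleE poi_mul_linearl.
- rewrite !(lcoef_cat, scaleE) !mulE scaler_sumr -big_split /=.
  by apply: eq_bigr => q _; rewrite lcoef_cat scaleE poi_mul_linearr.
- exact: mulA.
- exact: mulC.
- by rewrite lcoef_cat leibniz.
- by rewrite !(lcoef_cat, scaleE, dE) poi_d_linear.
- by rewrite lcoef_cat dmul.
- by rewrite lcoef_cat dbr.
Qed.

Definition laurent_congr : dp_congr k (Q * int).
Proof.
apply: (@DPCongr k _ laurent_rel).
- by [].
- by move=> x y H w.
- by move=> y x z H H' w; rewrite H H'.
- by move=> x x' y y' H H' w /=; rewrite !lcoef_cat H H'.
- by move=> a x x' H w /=; rewrite !scaleE H.
(* One factor is replaced at a time: the expansion along the first factor exposes the coefficients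
   of the second, and conversely. *)
- move=> x x' y y' H H' w /=; rewrite mulE; under eq_bigr do rewrite H'.
  by rewrite -mulE !mulEr; under eq_bigr do rewrite H.
- move=> x x' y y' H H' w /=; rewrite brE; under eq_bigr do rewrite H'.
  by rewrite -brE !brEr; under eq_bigr do rewrite H.
- by move=> x x' H w /=; rewrite !dE H.
- exact: laurent_axiom.
Defined.

Definition laurent : diffPoissonAlgType k := dp_quot laurent_congr.

Let rep (f : laurent) := repr (f : {eq_quot dp_equiv laurent_congr}).

Definition coefL w (f : laurent) : Q := lcoef w (laurent_seq (rep f)).
Definition monoL (q : Q) w : laurent := dp_cls laurent_congr (DPVar (q, w)).

Let coefL_cls w t : coefL w (dp_cls laurent_congr t) = lcoef w (laurent_seq t).
Proof.
suff: laurent_congr (rep (dp_cls laurent_congr t)) t by exact.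
by apply/dp_clsP; rewrite /dp_cls /rep reprK.
Qed.

Lemma laurentP (f g : laurent) : (forall w, coefL w f = coefL w g) -> f = g.
Proof.
move: f g; apply: dp_clsW => s; apply: dp_clsW => t H.
by apply/dp_clsP => w; rewrite -!coefL_cls H.
Qed.

Lemma coefL_linear w : linear (coefL w).
Proof.
move=> a; apply: dp_clsW => s; apply: dp_clsW => t.
by rewrite -dp_clsZ -dp_clsD !coefL_cls /= lcoef_cat scaleE.
Qed.

Lemma coefLd w (f : laurent) : coefL w (poi_d f) = poi_d (coefL (w - 1) f).
Proof. by move: f; apply: dp_clsW => s; rewrite -dp_clsd !coefL_cls dE. Qed.

Lemma coefL_monoM w q e (f : laurent) :
  coefL w (poi_mul (monoL q e) f) = poi_mul q (coefL (w - e) f).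
Proof.
move: f; apply: dp_clsW => s.
rewrite -dp_clsM !coefL_cls [LHS](mulE w [:: (q, e)]).
by rewrite big_seq1.
Qed.

Lemma coefL_monoB w q e (f : laurent) :
  coefL w (lie_br (monoL q e) f) = lie_br q (coefL (w - e - 1) f).
Proof.
move: f; apply: dp_clsW => s.
rewrite -dp_clsB !coefL_cls [LHS](brE w [:: (q, e)]).
by rewrite big_seq1.
Qed.

Lemma coefL_mono w q e : coefL w (monoL q e) = if e == w then q else 0.
Proof. by rewrite coefL_cls lcoef1. Qed.

End Laurent.

(** * The ideal of [Q[t, 1/t]] built from [I], and the resulting quotient *)

Section Filtration.
Variables (k : fieldType) (Q : diffPoissonAlgType k).
Variables (S I : Q -> Prop).
Implicit Types q s : Q.

Hypothesis S_circ : forall s s', S s -> S s' -> S (poi_mul s (poi_d s')).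
Hypothesis S_br : forall s s', S s -> S s' -> S (lie_br s s').
Hypothesis I_lin : forall a q q', I q -> I q' -> I (a *: q + q').
Hypothesis I0 : I 0.
Hypothesis I_circr : forall s q, S s -> I q -> I (poi_mul s (poi_d q)).
Hypothesis I_circl : forall s q, S s -> I q -> I (poi_mul q (poi_d s)).
Hypothesis I_br : forall s q, S s -> I q -> I (lie_br s q).

Fixpoint ideal_quot (n : nat) q : Prop :=
  if n is n'.+1 then forall s, S s -> ideal_quot n' (poi_mul s q) else I q.

(** Closure under linear combinations is built in, so that [S K] means the span of the products;
    proofs by induction then treat generators and combinations separately. *)
Inductive ideal_pow : nat -> Q -> Prop :=
| ideal_pow0 q : I q -> ideal_pow 0 q
| ideal_powM n s q : S s -> ideal_pow n q -> ideal_pow n.+1 (poi_mul s q)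
| ideal_pow_zero n : ideal_pow n 0
| ideal_pow_lin n a q q' :
    ideal_pow n q -> ideal_pow n q' -> ideal_pow n (a *: q + q').

(* [K_w] of the header: the coefficient of [t^(w - 1)] of the elements of the
   ideal, the shift being due to the weight [-1] of the elements of [S]. *)
Definition ideal_wt (w : int) : Q -> Prop :=
  match w with Posz n => ideal_quot n | Negz n => ideal_pow n.+1 end.

Lemma ideal_pow0E q : ideal_pow 0 q -> I q.
Proof.
move E : 0%N => n H; elim: H E => {n q} //=.
by move=> n a q q' _ IH _ IH' E; apply: I_lin; [apply: IH|apply: IH'].
Qed.

Lemma ideal_quot_zero n : ideal_quot n 0.
Proof.
elim: n => //= n IH s _.
by rewrite (linear_fun0 (poi_mul_linearr _)).
Qed.

Lemma ideal_quot_lin n a q q' :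
  ideal_quot n q -> ideal_quot n q' -> ideal_quot n (a *: q + q').
Proof.
elim: n q q' => /= [|n IH] q q' H H'; first exact: I_lin.
by move=> s Ss; rewrite poi_mul_linearr; apply: IH; [apply: H|apply: H'].
Qed.

Lemma ideal_wt0 w : ideal_wt w 0.
Proof. by case: w => n; [apply: ideal_quot_zero|apply: ideal_pow_zero]. Qed.

Lemma ideal_wt_lin w a q q' :
  ideal_wt w q -> ideal_wt w q' -> ideal_wt w (a *: q + q').
Proof. by case: w => n; [apply: ideal_quot_lin|apply: ideal_pow_lin]. Qed.

Lemma ideal_wtD w q q' : ideal_wt w q -> ideal_wt w q' -> ideal_wt w (q + q').
Proof. by rewrite -[q]scale1r; rewrite {1}scale1r; apply: ideal_wt_lin. Qed.

Lemma ideal_wtZ w a q : ideal_wt w q -> ideal_wt w (a *: q).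
Proof.
by move=> H; rewrite -[_ *: _]addr0; apply: ideal_wt_lin H (ideal_wt0 w).
Qed.

(** Above weight 0 this is the definition of [ideal_quot], below it a constructor of [ideal_pow]; at
    weight 0 it passes from [I] to [S I]. *)
Lemma ideal_wt_mul w s q :
  S s -> ideal_wt w q -> ideal_wt (w - 1) (poi_mul s q).
Proof.
move=> Ss; case: w => [[|n]|n] H.
- exact/ideal_powM/ideal_pow0.
- by rewrite (_ : _ - _ = Posz n); [apply: H|lia].
- by rewrite (_ : _ - _ = Negz n.+1); [apply: ideal_powM|lia].
Qed.

Lemma ideal_wt_mulS w s q :
  S s -> ideal_wt (w + 1) q -> ideal_wt w (poi_mul s q).
Proof. by move=> Ss /(ideal_wt_mul Ss); rewrite addrK. Qed.

(** Induction through [s' {s, q} = {s, s' q} - {s, s'} q], where [{s, s'}] is again in [S]. *)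
Lemma ideal_quot_br n s q :
  S s -> ideal_quot n q -> ideal_quot n (lie_br s q).
Proof.
move=> Ss; elim: n q => /= [|n IH] q H; first exact: I_br.
move=> s' Ss'.
have -> : poi_mul s' (lie_br s q) =
    lie_br s (poi_mul s' q) - poi_mul (lie_br s s') q.
  by rewrite poi_leibniz [poi_mul q _]poi_mulC addrK.
rewrite -scaleN1r addrC; apply: ideal_quot_lin; last by apply/IH/H.
exact/H/S_br.
Qed.

Lemma ideal_pow_br n s q :
  S s -> ideal_pow n q -> ideal_pow n (lie_br s q).
Proof.
move=> Ss; elim=> {n q} [q Iq|n s' q Ss' H IH|n|n a q q' H IH H' IH'].
- exact/ideal_pow0/I_br.
- rewrite poi_leibniz -[poi_mul s' _]scale1r poi_mulC.
  apply: ideal_pow_lin; first by rewrite poi_mulC; apply: ideal_powM.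
  by rewrite poi_mulC; apply: ideal_powM => //; apply: S_br.
- by rewrite (linear_fun0 (lie_br_linearr _)); apply: ideal_pow_zero.
- by rewrite lie_br_linearr; apply: ideal_pow_lin.
Qed.

Lemma ideal_wt_br w s q : S s -> ideal_wt w q -> ideal_wt w (lie_br s q).
Proof. by case: w => n; [apply: ideal_quot_br|apply: ideal_pow_br]. Qed.

(** At the bottom, [s d(q)] is the product of [s] and [q] in [Q^(d)], which [I] absorbs. Above,
    [s' s d(q) = s' d(s q) - (s' d(s)) q], where [s' d(s)] lies in [S]. *)
Lemma ideal_quot_d n q : ideal_quot n q -> ideal_quot n.+1 (poi_d q).
Proof.
elim: n q => [|n IH] q H s Ss; first exact: I_circr.
move=> s' Ss'.
have -> : poi_mul s' (poi_mul s (poi_d q)) =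
    poi_mul s' (poi_d (poi_mul s q)) - poi_mul (poi_mul s' (poi_d s)) q.
  by rewrite poi_d_mul (linear_funD (poi_mul_linearr _)) !poi_mulA addrK.
rewrite -scaleN1r addrC; apply: ideal_quot_lin; last by apply: IH (H s Ss) _ _.
by apply: H; apply: S_circ.
Qed.

(** The factor [d(s)] need not lie in [S], but it is absorbed by its neighbour:
    [d(s) s' q = (s' d(s)) q] with [s' d(s)] in [S], and [q d(s)] is in [I] for [q] in [I]. *)
Lemma ideal_pow_muld n s q :
  S s -> ideal_pow n q -> ideal_pow n (poi_mul (poi_d s) q).
Proof.
move=> Ss; elim=> {n q} [q Iq|n s' q Ss' H _|n|n a q q' _ IH _ IH'].
- by apply: ideal_pow0; rewrite poi_mulC; apply: I_circl.
- rewrite poi_mulA [poi_mul (poi_d s) _]poi_mulC.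
  by apply: ideal_powM => //; apply: S_circ.
- by rewrite (linear_fun0 (poi_mul_linearr _)); apply: ideal_pow_zero.
- by rewrite poi_mul_linearr; apply: ideal_pow_lin.
Qed.

Lemma ideal_pow_d n q : ideal_pow n.+1 q -> ideal_pow n (poi_d q).
Proof.
move E : n.+1 => m H.
elim: H n E => {m q} [//|m s q Ss Hq IH n [->]|m n _|m a q q' _ IH _ IH' n E].
- rewrite poi_d_mul -[poi_mul s _]scale1r.
  apply: ideal_pow_lin; last exact: ideal_pow_muld.
  (* The induction hypothesis says nothing for [q] in [I], where [d(q)] has positive weight; there
     [s d(q)] is in [I] directly. *)
  case: m Hq IH => [/ideal_pow0E Iq _|m _ IH].
    exact/ideal_pow0/I_circr.
  by apply: ideal_powM => //; apply: IH.
- by rewrite (linear_fun0 poi_d_linear); apply: ideal_pow_zero.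
- by rewrite poi_d_linear; apply: ideal_pow_lin; [apply: IH|apply: IH'].
Qed.

Lemma ideal_wt_d w q : ideal_wt w q -> ideal_wt (w + 1) (poi_d q).
Proof.
case: w => [n|[|n]] H.
- by rewrite (_ : _ + _ = Posz n.+1); [apply: ideal_quot_d|lia].
- exact/ideal_pow0E/ideal_pow_d.
- by rewrite (_ : _ + _ = Negz n); [apply: ideal_pow_d|lia].
Qed.

Definition laurent_ideal (f : laurent Q) : Prop :=
  forall w, ideal_wt (w + 1) (coefL w f).

Lemma laurent_ideal_lin a f g :
  laurent_ideal f -> laurent_ideal g -> laurent_ideal (a *: f + g).
Proof. by move=> Jf Jg w; rewrite coefL_linear; apply: ideal_wt_lin. Qed.

Lemma laurent_ideal0 : laurent_ideal 0.
Proof.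
by move=> w; rewrite (linear_fun0 (coefL_linear w)); apply: ideal_wt0.
Qed.

Lemma laurent_idealZ a f : laurent_ideal f -> laurent_ideal (a *: f).
Proof.
by move=> Jf; rewrite -[_ *: _]addr0; apply/laurent_ideal_lin/laurent_ideal0.
Qed.

Lemma laurent_idealD f g :
  laurent_ideal f -> laurent_ideal g -> laurent_ideal (f + g).
Proof. by rewrite -{2}[f]scale1r; apply: laurent_ideal_lin. Qed.

Lemma laurent_idealN f : laurent_ideal f -> laurent_ideal (- f).
Proof. by rewrite -scaleN1r; apply: laurent_idealZ. Qed.

Lemma laurent_ideal_d f : laurent_ideal f -> laurent_ideal (poi_d f).
Proof.
move=> Jf w; rewrite coefLd.
by have := ideal_wt_d (Jf (w - 1)); rewrite subrK.
Qed.

Lemma laurent_ideal_mono q : I q -> laurent_ideal (monoL q (-1)).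
Proof.
(* At exponent -1 the weight [w + 1] computes to 0, and [K_0] is [I]. *)
move=> Iq w; rewrite coefL_mono; case: eqP => [<-|_]; last exact: ideal_wt0.
exact: Iq.
Qed.

Lemma laurent_ideal_monoE q : laurent_ideal (monoL q (-1)) -> I q.
Proof. by move/(_ (-1)); rewrite coefL_mono eqxx. Qed.

Variables (X : Type) (x : X -> Q).
Hypothesis Sx : forall i, S (x i).

(** Exponent -1 is the one preserved by the GD operations: both [f d(g)] and the bracket contribute
    one factor [t], and [-1 - 1 + 1 = -1]. *)
Definition laurent_var i : laurent Q := monoL (x i) (-1).

(** The two claims need a joint induction: bracketing with a product uses multiplication, and
    multiplying by a bracket uses bracketing. The Leibniz rules and the Jacobi identity reduce each
    compound term to its parts, the case of [d] also using stability of the ideal under [d]. *)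
Lemma laurent_ideal_stable (t : dp_term k X) f : laurent_ideal f ->
  laurent_ideal (poi_mul (dp_eval laurent_var t) f) /\
  laurent_ideal (lie_br (dp_eval laurent_var t) f).
Proof.
elim: t f => [i||s IHs t IHt|a t IHt|s IHs t IHt|s IHs t IHt|t IHt] f Jf /=.
(* Multiplication by [s t^-1] uses the coefficient of [f] at [w + 1], of weight [w + 2], and [S]
   lowers the weight by 1. In the bracket the extra [t] cancels [t^-1], so exponent and weight stay
   put. *)
- split=> w; rewrite ?coefL_monoM ?coefL_monoB opprK ?addrK.
    by apply: ideal_wt_mulS => //; apply: Jf.
  by apply: ideal_wt_br => //; apply: Jf.
- rewrite (linear_fun0 (poi_mul_linearl _)) (linear_fun0 (lie_br_linearl _)).
  by split; apply: laurent_ideal0.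
- have [? ?] := IHs f Jf; have [? ?] := IHt f Jf.
  rewrite (linear_funD (poi_mul_linearl _)) (linear_funD (lie_br_linearl _)).
  by split; apply: laurent_idealD.
- have [? ?] := IHt f Jf.
  rewrite (linear_funZ (poi_mul_linearl _)) (linear_funZ (lie_br_linearl _)).
  by split; apply: laurent_idealZ.
- have [Ms Bs] := IHs f Jf; have [Mt Bt] := IHt f Jf.
  rewrite -poi_mulA poi_leibnizl; split; first exact: (IHs _ Mt).1.
  by apply: laurent_idealD; [apply: (IHs _ Bt).1|apply: (IHt _ Bs).1].
- have [Ms Bs] := IHs f Jf; have [Mt Bt] := IHt f Jf; split.
    have -> : poi_mul (lie_br (dp_eval laurent_var s) (dp_eval laurent_var t)) f
      = lie_br (dp_eval laurent_var s) (poi_mul (dp_eval laurent_var t) f)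
        - poi_mul (dp_eval laurent_var t) (lie_br (dp_eval laurent_var s) f).
      by rewrite poi_leibniz addrC addKr poi_mulC.
    by apply/laurent_idealD/laurent_idealN;
      [apply: (IHs _ Mt).2|apply: (IHt _ Bs).1].
  rewrite lie_jacobil; apply/laurent_idealD/laurent_idealN.
    exact: (IHs _ Bt).2.
  exact: (IHt _ Bs).2.
- have [Mt Bt] := IHt f Jf; have [Mt' Bt'] := IHt _ (laurent_ideal_d Jf); split.
    have -> : poi_mul (poi_d (dp_eval laurent_var t)) f =
      poi_d (poi_mul (dp_eval laurent_var t) f)
        - poi_mul (dp_eval laurent_var t) (poi_d f).
      by rewrite poi_d_mul addrC addKr.
    by apply/laurent_idealD/laurent_idealN => //; apply: laurent_ideal_d.
  have -> : lie_br (poi_d (dp_eval laurent_var t)) f =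
      poi_d (lie_br (dp_eval laurent_var t) f)
        - lie_br (dp_eval laurent_var t) (poi_d f).
    by rewrite poi_d_br addrK.
  by apply/laurent_idealD/laurent_idealN => //; apply: laurent_ideal_d.
Qed.

(** Pulling the ideal back to terms gives the quotient of the subalgebra generated by the
    [laurent_var i], without constructing that subalgebra. *)
Definition gd_quot_rel (s t : dp_term k X) : Prop :=
  laurent_ideal (dp_eval laurent_var s - dp_eval laurent_var t).

Definition gd_quot_congr : dp_congr k X.
Proof.
apply: (@DPCongr k X gd_quot_rel); rewrite /gd_quot_rel /=.
- by move=> s; rewrite subrr; apply: laurent_ideal0.
- by move=> s t /laurent_idealN; rewrite opprB.
- move=> t s u H H'; rewrite -(subrKA (dp_eval laurent_var t)).
  exact: laurent_idealD.
- move=> s s' t t' H H'; rewrite opprD addrACA.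
  exact: laurent_idealD.
- by move=> a s s' H; rewrite -scalerBr; apply: laurent_idealZ.
- move=> s s' t t' H H'.
  rewrite -(subrKA (poi_mul (dp_eval laurent_var s') (dp_eval laurent_var t))).
  rewrite -(linear_funB (poi_mul_linearr _)) -(linear_funB (poi_mul_linearl _)).
  apply: laurent_idealD; last exact: (laurent_ideal_stable _ H').1.
  by rewrite poi_mulC; apply: (laurent_ideal_stable _ H).1.
- move=> s s' t t' H H'.
  rewrite -(subrKA (lie_br (dp_eval laurent_var s') (dp_eval laurent_var t))).
  rewrite -(linear_funB (lie_br_linearr _)) -(linear_funB (lie_br_linearl _)).
  apply: laurent_idealD; last exact: (laurent_ideal_stable _ H').2.
  by rewrite lie_brC; apply/laurent_idealN/(laurent_ideal_stable _ H).2.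
- move=> s s' H; rewrite -(linear_funB poi_d_linear).
  exact: laurent_ideal_d.
- move=> s t /(dp_axiom_eval laurent_var) ->; rewrite subrr.
  exact: laurent_ideal0.
Defined.

Definition gd_quot : diffPoissonAlgType k := dp_quot gd_quot_congr.

Definition gd_quot_var i : gd_quot := dp_cls gd_quot_congr (DPVar i).

Lemma gd_quot_varP i j : gd_quot_var i = gd_quot_var j <-> I (x i - x j).
Proof.
have monoB q q' :
    monoL q (-1) - monoL q' (-1) = monoL (q - q') (-1) :> laurent Q.
  apply: laurentP => w; rewrite (linear_funB (coefL_linear w)) !coefL_mono.
  by case: ifP; rewrite ?subr0.
rewrite /gd_quot_var; split=> [/dp_clsP|H].
  rewrite /= /gd_quot_rel /= /laurent_var monoB; exact: laurent_ideal_monoE.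
apply/dp_clsP; rewrite /= /gd_quot_rel /= /laurent_var monoB.
exact: laurent_ideal_mono.
Qed.

Lemma gd_quot_var_lin a i j l : I (x l - (a *: x i + x j)) ->
  gd_quot_var l = a *: gd_quot_var i + gd_quot_var j.
Proof.
move=> H; rewrite /gd_quot_var -dp_clsZ -dp_clsD; apply/dp_clsP.
rewrite /= /gd_quot_rel /= (_ : _ - _ = monoL (x l - (a *: x i + x j)) (-1)).
  exact: laurent_ideal_mono.
apply: laurentP => w.
rewrite (linear_funB (coefL_linear w)) coefL_linear !coefL_mono.
by case: ifP; rewrite ?scaler0 ?addr0 ?subr0.
Qed.

(** The difference of the two sides is a single monomial of exponent -1 with coefficient in [I]. In
    use, [l] is the product of [i] and [j] computed in the GD-algebra that indexes the
    generators. *)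
Lemma gd_quot_var_circ i j l : I (x l - poi_mul (x i) (poi_d (x j))) ->
  gd_quot_var l = poi_mul (gd_quot_var i) (poi_d (gd_quot_var j)).
Proof.
move=> H; rewrite /gd_quot_var -dp_clsd -dp_clsM; apply/dp_clsP.
rewrite /= /gd_quot_rel /=.
rewrite (_ : _ - _ = monoL (x l - poi_mul (x i) (poi_d (x j))) (-1)).
  exact: laurent_ideal_mono.
apply: laurentP => w.
rewrite (linear_funB (coefL_linear w)) coefL_monoM coefLd !coefL_mono.
rewrite opprK addrK; case: ifP => // _; rewrite (linear_fun0 poi_d_linear).
by rewrite (linear_fun0 (poi_mul_linearr _)) subr0.
Qed.

Lemma gd_quot_var_br i j l : I (x l - lie_br (x i) (x j)) ->
  gd_quot_var l = lie_br (gd_quot_var i) (gd_quot_var j).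
Proof.
move=> H; rewrite /gd_quot_var -dp_clsB; apply/dp_clsP.
rewrite /= /gd_quot_rel /=.
rewrite (_ : _ - _ = monoL (x l - lie_br (x i) (x j)) (-1)).
  exact: laurent_ideal_mono.
apply: laurentP => w.
rewrite (linear_funB (coefL_linear w)) coefL_monoB !coefL_mono opprK addrK.
by case: ifP; rewrite ?(linear_fun0 (lie_br_linearr _)) ?subr0.
Qed.

End Filtration.

(** * Renaming and evaluation of GD-polynomials *)

Fixpoint gd_rename (k : fieldType) (r : nat -> nat) (p : gd_poly k) :
    gd_poly k :=
  match p with
  | GDVar n => GDVar k (r n)
  | GDZero => GDZero k
  | GDAdd p q => GDAdd (gd_rename r p) (gd_rename r q)
  | GDScale a p => GDScale a (gd_rename r p)
  | GDCirc p q => GDCirc (gd_rename r p) (gd_rename r q)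
  | GDBr p q => GDBr (gd_rename r p) (gd_rename r q)
  end.

Lemma gd_eval_rename (k : fieldType) (V : gdAlgType k) (v : nat -> V) r p :
  gd_eval v (gd_rename r p) = gd_eval (v \o r) p.
Proof. by elim: p => //= [p -> q ->|a p ->|p -> q ->|p -> q ->]. Qed.

Lemma gd_eval_ext (k : fieldType) (V : gdAlgType k) (v v' : nat -> V) p :
  v =1 v' -> gd_eval v p = gd_eval v' p.
Proof. by move=> /funext ->. Qed.

Lemma gd_hom_eval (k : fieldType) (V W : gdAlgType k) (f : V -> W) v p :
  gd_hom f -> f (gd_eval v p) = gd_eval (f \o v) p.
Proof.
case=> f_lin f_circ f_br.
elim: p => //= [|p IHp q IHq|a p IHp|p IHp q IHq|p IHp q IHq].
- exact: linear_fun0.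
- by rewrite (linear_funD f_lin) IHp IHq.
- by rewrite (linear_funZ f_lin) IHp.
- by rewrite f_circ IHp IHq.
- by rewrite f_br IHp IHq.
Qed.

Fixpoint dp_of_gd (k : fieldType) (X : Type) (g : nat -> X) (p : gd_poly k) :
    dp_term k X :=
  match p with
  | GDVar n => DPVar (g n)
  | GDZero => DPZero
  | GDAdd p q => DPAdd (dp_of_gd g p) (dp_of_gd g q)
  | GDScale a p => DPScale a (dp_of_gd g p)
  | GDCirc p q => DPMul (dp_of_gd g p) (DPD (dp_of_gd g q))
  | GDBr p q => DPBr (dp_of_gd g p) (dp_of_gd g q)
  end.

Lemma dp_eval_of_gd (k : fieldType) (X : Type) (g : nat -> X)
    (P : diffPoissonAlgType k) (f : X -> P) p :
  dp_eval f (dp_of_gd g p) = gd_eval (V := gd_of P) (f \o g) p.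
Proof. by elim: p => //= [p -> q ->|a p ->|p -> q ->|p -> q ->]. Qed.

Lemma dp_free_eval (k : fieldType) (X : Type) (t : dp_term k X) :
  dp_eval (@dp_free_var k X) t = dp_cls (dp_free_congr k X) t.
Proof.
elim: t => //= [s -> t ->|a t ->|s -> t ->|s -> t ->|t ->].
- by rewrite dp_clsD.
- by rewrite dp_clsZ.
- by rewrite dp_clsM.
- by rewrite dp_clsB.
- by rewrite dp_clsd.
Qed.

(** Universal property: a relation between the free generators holds for any elements of any [P]. *)
Lemma dp_free_eval0 (k : fieldType) (X : Type) (t : dp_term k X)
    (P : diffPoissonAlgType k) (f : X -> P) :
  dp_eval (@dp_free_var k X) t = 0 -> dp_eval f t = 0.
Proof. by rewrite dp_free_eval -dp_cls0 => /dp_clsP /(_ P f). Qed.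

(** * The evaluation from [S] to [V] and the embedding of [V] *)

Section Special.
Variables (k : fieldType) (V : gdAlgType k).

Let Q := dp_free k V.
Let x : V -> Q := @dp_free_var k V.

(** The evaluation is kept as a relation, pairing the values of one polynomial in [Q] and in [V]; it
    is single-valued only thanks to the identities of [V]. *)
Definition gd_graph (q : Q) (v : V) : Prop :=
  exists (p : gd_poly k) (g : nat -> V),
    gd_eval (V := gd_of Q) (x \o g) p = q /\ gd_eval g p = v.

Lemma gd_graph_var v : gd_graph (x v) v.
Proof. by exists (GDVar k 0), (fun=> v). Qed.

(** Interleaving makes two polynomials with unrelated assignments share one, after renaming their
    variables to odd and even indices. *)
Let merge (g1 g2 : nat -> V) n := if odd n then g1 n./2 else g2 n./2.

Let mergel (g1 g2 : nat -> V) n : merge g1 g2 n.*2.+1 = g1 n.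
Proof. by rewrite /merge /= odd_double uphalf_double. Qed.

Let merger (g1 g2 : nat -> V) n : merge g1 g2 n.*2 = g2 n.
Proof. by rewrite /merge /= odd_double doubleK. Qed.

Lemma gd_graph_common q v q' v' : gd_graph q v -> gd_graph q' v' ->
  exists p p' g,
    [/\ gd_eval (V := gd_of Q) (x \o g) p = q, gd_eval g p = v,
        gd_eval (V := gd_of Q) (x \o g) p' = q' & gd_eval g p' = v'].
Proof.
move=> [p [g [<- <-]]] [p' [g' [<- <-]]].
exists (gd_rename (fun n => n.*2.+1) p), (gd_rename double p'), (merge g g').
by split; rewrite gd_eval_rename; apply: gd_eval_ext => n /=;
  rewrite ?mergel ?merger.
Qed.

Lemma gd_graph_lin a q v q' v' : gd_graph q v -> gd_graph q' v' ->
  gd_graph (a *: q + q') (a *: v + v').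
Proof.
move=> H /(gd_graph_common H) [p [p' [g [<- <- <- <-]]]].
by exists (GDAdd (GDScale a p) p'), g.
Qed.

Lemma gd_graph_circ q v q' v' : gd_graph q v -> gd_graph q' v' ->
  gd_graph (poi_mul q (poi_d q')) (nov_mul v v').
Proof.
move=> H /(gd_graph_common H) [p [p' [g [<- <- <- <-]]]].
by exists (GDCirc p p'), g.
Qed.

Lemma gd_graph_br q v q' v' : gd_graph q v -> gd_graph q' v' ->
  gd_graph (lie_br q q') (lie_br v v').
Proof.
move=> H /(gd_graph_common H) [p [p' [g [<- <- <- <-]]]].
by exists (GDBr p p'), g.
Qed.

Lemma gd_graph_sub q v q' v' : gd_graph q v -> gd_graph q' v' ->
  gd_graph (q - q') (v - v').
Proof.
move=> H H'; have := gd_graph_lin (-1) H' H.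
by rewrite !scaleN1r ![- _ + _]addrC.
Qed.

Lemma gd_graph0 : gd_graph 0 0.
Proof. by exists (GDZero k), (fun=> 0). Qed.

Hypothesis V_ids : forall p : gd_poly k,
  (forall P : diffPoissonAlgType k, gd_satisfies (gd_of P) p) ->
  gd_satisfies V p.

(* [gd_eval (x \o g) p = 0] is an identity only for assignments constant on the
   fibres of [g], so the variables in each fibre are first identified. *)
Lemma gd_graph_fun v : gd_graph 0 v -> v = 0.
Proof.
move=> [p [g [p0 <-]]].
have [r rP] : {r : V -> nat | forall n, g (r (g n)) = g n}.
  pose R v m := (exists n, g n = v) -> g m = v.
  suff /choice [r rP] : forall v, exists m, R v m.
    by apply: cid; exists r => n; apply: rP; exists n.
  move=> u; have [[n <-]|H] := pselect (exists n, g n = u); first by exists n.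
  by exists 0%N.
have -> : gd_eval g p = gd_eval g (gd_rename (r \o g) p).
  by rewrite gd_eval_rename; apply: gd_eval_ext => n /=; rewrite rP.
(* Every assignment [w] of the renamed polynomial factors through [g], and [w \o r] is an assignment
   of the free generators; so the relation in [Q] carries over to [P]. *)
apply: V_ids => P w; rewrite gd_eval_rename.
rewrite -[_ \o _]/((w \o r) \o g) -dp_eval_of_gd.
by apply: dp_free_eval0; rewrite dp_eval_of_gd.
Qed.

Let S q := exists v, gd_graph q v.
Let I q := gd_graph q 0.

Let S_circ s s' : S s -> S s' -> S (poi_mul s (poi_d s')).
Proof. by move=> [v H] [v' H']; exists (nov_mul v v'); apply: gd_graph_circ. Qed.

Let S_br s s' : S s -> S s' -> S (lie_br s s').
Proof. by move=> [v H] [v' H']; exists (lie_br v v'); apply: gd_graph_br. Qed.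

Let I_lin a q q' : I q -> I q' -> I (a *: q + q').
Proof. by move=> H H'; have := gd_graph_lin a H H'; rewrite scaler0 addr0. Qed.

Let I_circr s q : S s -> I q -> I (poi_mul s (poi_d q)).
Proof.
move=> [v H] H'; have := gd_graph_circ H H'.
by rewrite (linear_fun0 (nov_mul_linearr _)).
Qed.

Let I_circl s q : S s -> I q -> I (poi_mul q (poi_d s)).
Proof.
move=> [v H] H'; have := gd_graph_circ H' H.
by rewrite (linear_fun0 (nov_mul_linearl _)).
Qed.

Let I_br s q : S s -> I q -> I (lie_br s q).
Proof.
move=> [v H] H'; have := gd_graph_br H H'.
by rewrite (linear_fun0 (lie_br_linearr _)).
Qed.

Let Sx v : S (x v).
Proof. by exists v; apply: gd_graph_var. Qed.

Lemma special_of_identities : special V.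
Proof.
pose P := gd_quot S_circ S_br I_lin gd_graph0 I_circr I_circl I_br Sx.
pose f : V -> gd_of P := @gd_quot_var k Q S I S_circ S_br I_lin gd_graph0
  I_circr I_circl I_br V x Sx.
(* Both [x v] and [q] evaluate to [v], so their difference is in the kernel; this yields the
   congruences modulo [I] that make [f] a homomorphism. *)
have xI q v : gd_graph q v -> I (x v - q).
  by move=> H; have := gd_graph_sub (gd_graph_var v) H; rewrite subrr.
exists P, f; split; first split.
- move=> a u v; apply/gd_quot_var_lin/xI/gd_graph_lin; exact: gd_graph_var.
- move=> u v; apply/gd_quot_var_circ/xI/gd_graph_circ; exact: gd_graph_var.
- move=> u v; apply/gd_quot_var_br/xI/gd_graph_br; exact: gd_graph_var.
(* The element [x u - x v] is related both to [u - v] and, being in [I], to 0; subtracting, 0 is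
   related to [u - v]. *)
move=> u v /gd_quot_varP H; apply/eqP; rewrite -subr_eq0; apply/eqP/gd_graph_fun.
have := gd_graph_sub (gd_graph_sub (gd_graph_var u) (gd_graph_var v)) H.
by rewrite subrr subr0.
Qed.

End Special.

Theorem corollary1 (k : fieldType) :
  exists Ids : gd_poly k -> Prop,
    forall V : gdAlgType k,
      special V <-> (forall p : gd_poly k, Ids p -> gd_satisfies V p).
Proof.
(* The identities common to all [P^(d)]. They hold in special algebras because an injective
   homomorphism reflects the vanishing of a polynomial. *)
exists (fun p => forall P : diffPoissonAlgType k, gd_satisfies (gd_of P) p).
move=> V; split=> [[P [f [f_hom f_inj]]] p p_id v|]; last first.
  exact: special_of_identities.
have f0 : f 0 = 0 by case: f_hom => f_lin _ _; apply: linear_fun0.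
by apply: f_inj; rewrite f0 (gd_hom_eval _ _ f_hom); apply: p_id.
Qed.
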